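(* Let $x$ range over $(0,\pi/2)$ and let $(p,q)$ satisfy $p\le 0$ or $0<p\le 3q$. (i) If $p\ge\frac75$, then $\frac{\sin x}{x}<M(\cos x;p,q)$ holds for all $x\in(0,\pi/2)$ if and only if $q\ge \frac p3+\frac8{15}$. (ii) If $p\ge p_0$, then $\frac{\sin x}{x}>M(\cos x;p,q)$ holds for all $x\in(0,\pi/2)$ if and only if $q\le q(p)$. (iii) If $p\le\frac{46}{35}$, then $\frac{\sin x}{x}>M(\cos x;p,q)$ holds for all $x\in(0,\pi/2)$ if and only if $q\le\frac p3+\frac8{15}$. (iv) If $p\le p_0^*$, then $\frac{\sin x}{x}<M(\cos x;p,q)$ holds for all $x\in(0,\pi/2)$ if and only if $q\ge q(p)$.
   Context: For $t\in(0,1)$: $M(t;p,q)=\left(1-\frac{p}{3q}+\frac{p}{3q}t^q\right)^{1/p}$ if $pq\ne0$; $M(t;0,q)=\exp\frac{t^q-1}{3q}$ if $q\neq 0$; $M(t;p,0)=\left(1+\frac p3\ln t\right)^{1/p}$ if $p\ne0$; $M(t;0,0)=t^{1/3}$. Further $q(p)=\frac{p}{3(1-(2/\pi)^p)}$ for $p\ne0$ and $q(0)=-\frac{1}{3\ln(2/\pi)}$. The number $p_0\approx1.42034$ is the unique real $p$ with $q(p)=1$, and $p_0^*\approx1.27754$ is the unique real $p$ with $q(p)=\frac{34}{35}$. *)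

(* Defs.v *)
From Stdlib Require Export Reals.
Open Scope R_scope.

(* M(t;p,q) for t in (0,1). t^q is Rpower t q (t > 0). The outer 1/p power is
   taken with Rpower; under the standing assumption (p <= 0 or 0 < p <= 3q)
   the base is always > 0 for t in (0,1). *)
Definition M (t p q : R) : R :=
  if Req_EM_T p 0 then
    (if Req_EM_T q 0 then Rpower t (1/3) else exp ((Rpower t q - 1) / (3 * q)))
  else
    (if Req_EM_T q 0 then Rpower (1 + p / 3 * ln t) (1 / p)
     else Rpower (1 - p / (3 * q) + p / (3 * q) * Rpower t q) (1 / p)).

Definition qfun (p : R) : R :=
  if Req_EM_T p 0 then - (1 / (3 * ln (2 / PI)))
  else p / (3 * (1 - Rpower (2 / PI) p)).

(* Main.v *)
(* Put [gap p y] for the integral of [s ^ (p - 1)] over [[y, 1]].  Then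
   [sin x / x < M (cos x) p q] iff [F x = gap p (sin x / x) - gap q (cos x) / 3]
   is positive, and [F] vanishes at [0].  Its derivative is a positive function
   times [k = h - 1/3], where [h] is the ratio of the derivatives of the two gaps;
   [k] vanishes at [0] too, and [k'] has the sign of
   [m = alpha + (q - 1) tau - (p - 1)], where [alpha] and [tau] do not depend on
   [p, q].  Since [alpha], [tau] and [tau / 35 - alpha] are increasing, [m]
   increases when [q >= 1] and decreases when [q <= 34/35]; its limit at [0] is
   [3 q - p - 8/5].  Hence for [q = p/3 + 8/15] the sign of [m], and so of [F], is
   constant.  As [gap] decreases in its exponent, [qfun] increases, so [p >= p0] and
   [p <= p0s] put [qfun p] in these two ranges.  For [q = qfun p] the function [F] also vanishes at [pi/2], and being
   first monotone one way and then the other it keeps one sign in between. *)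
Require Import Defs.
From Stdlib Require Import Reals ZArith Lra Lia Psatz Classical.
From Coquelicot Require Import Coquelicot.
Open Scope R_scope.

(** * Monotonicity from the mean value theorem *)

Lemma mean_value (f df : R -> R) (a b : R) :
  a < b -> (forall x, a <= x <= b -> is_derive f x (df x)) ->
  exists c, a < c < b /\ f b - f a = df c * (b - a).
Proof.
intros ab Hf.
destruct (MVT_cor2 f df a b ab) as [c [Hc1 Hc2]].
- intros c Hc; apply is_derive_Reals; auto.
- exists c; auto.
Qed.

Lemma derive_pos_lt (f df : R -> R) (a b : R) :
  a < b -> (forall x, a <= x <= b -> is_derive f x (df x)) ->
  (forall x, a < x < b -> 0 < df x) -> f a < f b.
Proof.
intros ab Hf Hdf.
destruct (mean_value f df a b ab Hf) as [c [Hc E]].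
specialize (Hdf c Hc); nra.
Qed.

Lemma derive_nonneg_le (f df : R -> R) (a b : R) :
  a <= b -> (forall x, a <= x <= b -> is_derive f x (df x)) ->
  (forall x, a < x < b -> 0 <= df x) -> f a <= f b.
Proof.
intros [ab | ->] Hf Hdf; [| lra].
destruct (mean_value f df a b ab Hf) as [c [Hc E]].
specialize (Hdf c Hc); nra.
Qed.

Lemma is_derive_Rplus (f g : R -> R) (x l m : R) :
  is_derive f x l -> is_derive g x m -> is_derive (fun y => f y + g y) x (l + m).
Proof. exact (is_derive_plus f g x l m). Qed.

Lemma is_derive_Rminus (f g : R -> R) (x l m : R) :
  is_derive f x l -> is_derive g x m -> is_derive (fun y => f y - g y) x (l - m).
Proof. exact (is_derive_minus f g x l m). Qed.

(** * Taylor bounds for sine and cosine *)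

(* A factorial in [Z], so that concrete coefficients compute in binary. *)
Fixpoint Zfact (n : nat) : Z :=
  match n with O => 1%Z | S m => (Z.of_nat n * Zfact m)%Z end.

Lemma Zfact_pos (n : nat) : 0 < IZR (Zfact n).
Proof.
apply IZR_lt; induction n as [| n IH]; [reflexivity |].
change (0 < Z.of_nat (S n) * Zfact n)%Z; lia.
Qed.

Fixpoint cos_taylor (n : nat) (x : R) : R :=
  match n with
  | O => 1
  | S m => cos_taylor m x + (-1) ^ n * (/ IZR (Zfact (2 * n)) * x ^ (2 * n))
  end.

Fixpoint sin_taylor (n : nat) (x : R) : R :=
  match n with
  | O => x
  | S m => sin_taylor m x + (-1) ^ n * (/ IZR (Zfact (2 * n + 1)) * x ^ (2 * n + 1))
  end.

Lemma is_derive_taylor_term (n : nat) (x : R) :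
  is_derive (fun y => / IZR (Zfact (S n)) * y ^ S n) x (/ IZR (Zfact n) * x ^ n).
Proof.
replace (/ IZR (Zfact n) * x ^ n)
  with (/ IZR (Zfact (S n)) * (INR (S n) * 1 * x ^ pred (S n))).
- apply is_derive_scal, (is_derive_pow (fun y : R => y)).
  apply (is_derive_id (K := R_AbsRing)).
- replace (IZR (Zfact (S n))) with (INR (S n) * IZR (Zfact n))
    by (rewrite INR_IZR_INZ, <- mult_IZR; reflexivity).
  remember (INR (S n)) as c eqn:Ec.
  cbn [Nat.pred]; field; subst c.
  split; [apply Rgt_not_eq, Zfact_pos | apply not_0_INR; lia].
Qed.

Lemma is_derive_sin_taylor (n : nat) (x : R) :
  is_derive (sin_taylor n) x (cos_taylor n x).
Proof.
induction n as [| n IH]; [exact (is_derive_id x) |].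
cbn [sin_taylor cos_taylor].
apply is_derive_Rplus; [exact IH |].
apply is_derive_scal.
replace (2 * S n + 1)%nat with (S (2 * S n)) by lia.
apply is_derive_taylor_term.
Qed.

Lemma is_derive_cos_taylor (n : nat) (x : R) :
  is_derive (cos_taylor (S n)) x (- sin_taylor n x).
Proof.
induction n as [| n IH].
- simpl; auto_derive; [trivial | lra].
- change (cos_taylor (S (S n))) with (fun y => cos_taylor (S n) y
    + (-1) ^ S (S n) * (/ IZR (Zfact (2 * S (S n))) * y ^ (2 * S (S n)))).
  replace (- sin_taylor (S n) x) with (- sin_taylor n x
    + (-1) ^ S (S n) * (/ IZR (Zfact (2 * S n + 1)) * x ^ (2 * S n + 1))).
  + apply is_derive_Rplus; [exact IH |].
    apply is_derive_scal.
    replace (2 * S (S n))%nat with (S (2 * S n + 1)) by lia.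
    apply is_derive_taylor_term.
  + cbn [sin_taylor].
    change ((-1) ^ S (S n)) with (-1 * (-1) ^ S n); ring.
Qed.

Lemma cos_taylor_0 (n : nat) : cos_taylor n 0 = 1.
Proof.
induction n as [| n IH]; [reflexivity |].
cbn [cos_taylor]; rewrite IH, pow_i by lia; ring.
Qed.

Lemma sin_taylor_0 (n : nat) : sin_taylor n 0 = 0.
Proof.
induction n as [| n IH]; [reflexivity |].
cbn [sin_taylor]; rewrite IH, pow_i by lia; ring.
Qed.

(** Integration from 0 turns the cosine bound of order [n] into the sine bound of order [n], and
    this into the cosine bound of order [S n] with the opposite sign. The start is [cos x <= 1]. *)
Lemma taylor_alternate (n : nat) :
  (forall x, 0 <= x -> 0 <= (-1) ^ n * (cos_taylor n x - cos x)) /\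
  (forall x, 0 <= x -> 0 <= (-1) ^ n * (sin_taylor n x - sin x)).
Proof.
assert (step : forall n, (forall x, 0 <= x -> 0 <= (-1) ^ n * (cos_taylor n x - cos x)) ->
  forall x, 0 <= x -> 0 <= (-1) ^ n * (sin_taylor n x - sin x)).
{ intros m H x Hx.
  replace 0 with ((-1) ^ m * (sin_taylor m 0 - sin 0))
    by (rewrite sin_taylor_0, sin_0; ring).
  apply (derive_nonneg_le (fun y => (-1) ^ m * (sin_taylor m y - sin y))
    (fun y => (-1) ^ m * (cos_taylor m y - cos y))); [exact Hx | |].
  - intros y _; apply is_derive_scal, is_derive_Rminus;
      [apply is_derive_sin_taylor | apply is_derive_Reals, derivable_pt_lim_sin].
  - intros y Hy; apply H; lra. }
assert (Hc : forall x, 0 <= x -> 0 <= (-1) ^ n * (cos_taylor n x - cos x)).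
{ induction n as [| n IH]; intros x Hx.
  - simpl; generalize (COS_bound x); lra.
  - replace 0 with ((-1) ^ S n * (cos_taylor (S n) 0 - cos 0))
      by (rewrite cos_taylor_0, cos_0; ring).
    apply (derive_nonneg_le (fun y => (-1) ^ S n * (cos_taylor (S n) y - cos y))
      (fun y => (-1) ^ S n * (- sin_taylor n y - - sin y))); [exact Hx | |].
    + intros y _; apply is_derive_scal, is_derive_Rminus;
        [apply is_derive_cos_taylor | apply is_derive_Reals, derivable_pt_lim_cos].
    + intros y Hy; generalize (step n IH y (Rlt_le _ _ (proj1 Hy))).
      simpl; lra. }
split; [exact Hc | exact (step n Hc)].
Qed.

(* Adds the alternating bounds of order [n] for [cos (a * x)] and [sin (a * x)],
   multiplied by [x ^ d], with numeric coefficients: [lra] can then combine them,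
   treating each monomial as an atom. *)
Ltac weighted_taylor n a x d :=
  let H := fresh in
  let H' := fresh in
  let W := fresh in
  let W' := fresh in
  destruct (taylor_alternate n) as [H H'];
  specialize (H (a * x) ltac:(lra)); specialize (H' (a * x) ltac:(lra));
  assert (W := Rmult_le_pos (x ^ d) _ ltac:(apply pow_le; lra) H);
  assert (W' := Rmult_le_pos (x ^ d) _ ltac:(apply pow_le; lra) H');
  clear H H';
  cbn [cos_taylor sin_taylor Nat.mul Nat.add] in W, W';
  repeat match goal with
  | _ : context [Zfact ?k] |- _ =>
    let v := eval vm_compute in (Zfact k) in change (Zfact k) with v in W, W'
  end.

Lemma PI2_upper : PI / 2 < 17 / 10.
Proof.
destruct (Rlt_le_dec (PI / 2) (17 / 10)) as [h | h]; [exact h | exfalso].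
assert (H : 0 <= cos (1 * (17 / 10))) by (apply cos_ge_0; lra).
(* The Taylor polynomial of degree 4, an upper bound for the cosine, is negative at 17/10. *)
weighted_taylor 2%nat 1 (17 / 10) 0%nat; lra.
Qed.

(** * Positivity of the trigonometric numerators *)

(* [alpha_num] and [alpha_tau_num] are, in multiple angles, the numerators of
   [alpha - 2/5] and [11/35 - (alpha - tau / 35)]; the slope of [f] is [x f' - 6 f],
   so that it has the sign of the derivative of [f / x ^ 6].  Their Taylor bounds
   are [x ^ 8] or [x ^ 10] times polynomials in [x ^ 2] with alternating leading
   coefficients; the constants below are these coefficients, grouped in pairs. *)
Definition alpha_num (y : R) : R := 4 * y ^ 2 - 24 + (24 - y ^ 2) * cos y + 9 * y * sin y.

Definition alpha_num_slope (y : R) : R :=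
  - 16 * y ^ 2 + 144 + (13 * y ^ 2 - 144) * cos y + (y ^ 3 - 69 * y) * sin y.

Lemma alpha_num_bounds (x : R) : 0 < x < PI ->
  0 < alpha_num x <= x ^ 8 * (/ 5040 + / 40320 * x ^ 2).
Proof.
intros Hx; generalize PI2_upper; intros Hpi.
assert (Hx2 : x ^ 2 < 12) by nra.
assert (H1 : 0 < x ^ 8 * (/ 5040 - / 151200 * x ^ 2 - / 4435200 * (x ^ 2 * x ^ 2)))
  by (apply Rmult_lt_0_compat; [apply pow_lt; lra | nra]).
clear Hx2; unfold alpha_num.
replace (cos x) with (cos (1 * x)) by (f_equal; ring).
replace (sin x) with (sin (1 * x)) by (f_equal; ring).
split.
(* Odd orders bound from below and even orders from above, so the parity follows the sign of each
   trigonometric term; the last argument is the power of [x] in that term. *)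
- weighted_taylor 5%nat 1 x 0%nat.
  weighted_taylor 4%nat 1 x 2%nat.
  weighted_taylor 5%nat 1 x 1%nat.
  lra.
- weighted_taylor 4%nat 1 x 0%nat.
  weighted_taylor 3%nat 1 x 2%nat.
  weighted_taylor 4%nat 1 x 1%nat.
  lra.
Qed.

Lemma alpha_num_slope_pos (x : R) : 0 < x < PI -> 0 < alpha_num_slope x.
Proof.
intros Hx; generalize PI2_upper; intros Hpi.
assert (Hx2 : x ^ 2 < 12) by nra.
assert (H1 : 0 < x ^ 8 * (/ 2520 - / 37800 * x ^ 2))
  by (apply Rmult_lt_0_compat; [apply pow_lt |]; lra).
assert (H2 : 0 < x ^ 12 * (/ 1663200 - / 27675648 * x ^ 2))
  by (apply Rmult_lt_0_compat; [apply pow_lt |]; lra).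
clear Hx2; unfold alpha_num_slope.
replace (cos x) with (cos (1 * x)) by (f_equal; ring).
replace (sin x) with (sin (1 * x)) by (f_equal; ring).
weighted_taylor 5%nat 1 x 2%nat.
weighted_taylor 6%nat 1 x 0%nat.
weighted_taylor 5%nat 1 x 3%nat.
weighted_taylor 6%nat 1 x 1%nat.
lra.
Qed.

Definition alpha_tau_num (x : R) : R :=
  81 * cos x - 54 * x * sin x - 108 * x ^ 2 * cos x
    - 81 * cos (3 * x) - 58 * x * sin (3 * x) + 12 * x ^ 2 * cos (3 * x).

Definition alpha_tau_num_slope (x : R) : R :=
  - 486 * cos x + 189 * x * sin x + 378 * x ^ 2 * cos x + 108 * x ^ 3 * sin x
    + 486 * cos (3 * x) + 533 * x * sin (3 * x) - 222 * x ^ 2 * cos (3 * x)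
    - 36 * x ^ 3 * sin (3 * x).

Lemma alpha_tau_num_pos (x : R) : 0 < x < PI / 2 -> 0 < alpha_tau_num x.
Proof.
intros Hx; generalize PI2_upper; intros Hpi.
assert (Hx2 : x ^ 2 < 289 / 100) by nra.
assert (H1 : 0 < x ^ 10 * (64 / 525 - 32 / 1155 * x ^ 2))
  by (apply Rmult_lt_0_compat; [apply pow_lt |]; lra).
assert (H2 : 0 < x ^ 14 * (1528 / 525525 - 146146243 / 774918144000 * x ^ 2
    - 69353051 / 3293402112000 * (x ^ 2 * x ^ 2)))
  by (apply Rmult_lt_0_compat; [apply pow_lt; lra | nra]).
clear Hx2; unfold alpha_tau_num.
replace (cos x) with (cos (1 * x)) by (f_equal; ring).
replace (sin x) with (sin (1 * x)) by (f_equal; ring).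
weighted_taylor 7%nat 1 x 0%nat.
weighted_taylor 8%nat 1 x 1%nat.
weighted_taylor 6%nat 1 x 2%nat.
weighted_taylor 8%nat 3 x 0%nat.
weighted_taylor 8%nat 3 x 1%nat.
weighted_taylor 7%nat 3 x 2%nat.
lra.
Qed.

Lemma alpha_tau_num_slope_pos (x : R) : 0 < x < PI / 2 -> 0 < alpha_tau_num_slope x.
Proof.
intros Hx; generalize PI2_upper; intros Hpi.
assert (Hx2 : x ^ 2 < 289/100) by nra.
assert (H1 : 0 < x ^ 10 * (256 / 525 - 64 / 385 * x ^ 2))
  by (apply Rmult_lt_0_compat; [apply pow_lt |]; lra).
assert (H2 : 0 < x ^ 14 * (12224/525525 - 1784/945945 * x ^ 2))
  by (apply Rmult_lt_0_compat; [apply pow_lt |]; lra).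
assert (H3 : 0 < x ^ 18 * (1348796177/13173608448000 - 20457954157/1126343522304000 * x ^ 2))
  by (apply Rmult_lt_0_compat; [apply pow_lt |]; lra).
clear Hx2; unfold alpha_tau_num_slope.
replace (cos x) with (cos (1 * x)) by (f_equal; ring).
replace (sin x) with (sin (1 * x)) by (f_equal; ring).
weighted_taylor 8%nat 1 x 0%nat.
weighted_taylor 9%nat 1 x 1%nat.
weighted_taylor 7%nat 1 x 2%nat.
weighted_taylor 7%nat 1 x 3%nat.
weighted_taylor 9%nat 3 x 0%nat.
weighted_taylor 9%nat 3 x 1%nat.
weighted_taylor 8%nat 3 x 2%nat.
weighted_taylor 8%nat 3 x 3%nat.
lra.
Qed.

(** * Monotonicity of the trigonometric ratios *)

Definition increasing_on (f : R -> R) (b : R) : Prop :=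
  forall x y, 0 < x -> x < y -> y < b -> f x < f y.

Definition decreasing_on (f : R -> R) (b : R) : Prop :=
  forall x y, 0 < x -> x < y -> y < b -> f y < f x.

Lemma derive_increasing (f df : R -> R) (b : R) :
  (forall x, 0 < x < b -> is_derive f x (df x)) ->
  (forall x, 0 < x < b -> 0 < df x) -> increasing_on f b.
Proof.
intros Hf Hdf x y Hx Hxy Hy.
apply (derive_pos_lt f df); [exact Hxy | |]; intros z Hz; [apply Hf | apply Hdf]; lra.
Qed.

Lemma derive_decreasing (f df : R -> R) (b : R) :
  (forall x, 0 < x < b -> is_derive f x (df x)) ->
  (forall x, 0 < x < b -> df x < 0) -> decreasing_on f b.
Proof.
intros Hf Hdf x y Hx Hxy Hy.
apply Ropp_lt_cancel.
apply (derive_pos_lt (fun z => - f z) (fun z => - df z)); [exact Hxy | |]; intros z Hz.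
- apply (is_derive_opp (V := R_NormedModule) f), Hf; lra.
- generalize (Hdf z); lra.
Qed.

Lemma increasing_on_div (f g : R -> R) (b : R) :
  increasing_on f b -> decreasing_on g b ->
  (forall x, 0 < x < b -> 0 < f x) -> (forall x, 0 < x < b -> 0 < g x) ->
  increasing_on (fun x => f x / g x) b.
Proof.
intros Hf Hg f0 g0 x y Hx Hxy Hy; unfold Rdiv.
assert (gx : 0 < g x) by (apply g0; lra).
assert (gy : 0 < g y) by (apply g0; lra).
apply Rmult_le_0_lt_compat.
- left; apply f0; lra.
- left; apply Rinv_0_lt_compat; exact gx.
- apply Hf; lra.
- apply Rinv_lt_contravar; [nra | apply Hg; lra].
Qed.

(** Up to sign, the numerator of the derivative of [sin x / x]. *)
Definition sxc (x : R) : R := sin x - x * cos x.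

Lemma sin_cos_pos (x : R) : 0 < x < PI / 2 -> 0 < sin x /\ 0 < cos x.
Proof.
intros Hx; split; [apply sin_gt_0 | apply cos_gt_0]; lra.
Qed.

Lemma sxc_pos (x : R) : 0 < x < PI / 2 -> 0 < sxc x.
Proof.
intros Hx.
replace 0 with (sxc 0) by (unfold sxc; rewrite sin_0; ring).
apply (derive_pos_lt sxc (fun y => y * sin y)); [lra | |]; intros y Hy.
- unfold sxc; auto_derive; [trivial | ring].
- destruct (sin_cos_pos y); [lra | nra].
Qed.

Definition rho (x : R) : R := sxc x / x ^ 3.

Lemma rho_pos (x : R) : 0 < x < PI / 2 -> 0 < rho x.
Proof.
intros Hx; apply Rdiv_lt_0_compat; [apply sxc_pos, Hx | apply pow_lt; lra].
Qed.

(** The numerator of the derivative vanishes at 0 and has itself the derivative [- x * sxc x]. *)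
Lemma rho_decreasing : decreasing_on rho (PI / 2).
Proof.
apply (derive_decreasing rho (fun x => (x ^ 2 * sin x - 3 * sxc x) / x ^ 4)); intros x Hx.
- unfold rho, sxc; auto_derive; [| field]; repeat apply Rmult_integral_contrapositive_currified; lra.
- apply Ropp_lt_cancel; rewrite Ropp_0.
  unfold Rdiv; rewrite Ropp_mult_distr_l.
  apply Rdiv_lt_0_compat; [| apply pow_lt; lra].
  replace 0 with (- (0 ^ 2 * sin 0 - 3 * sxc 0)) by (unfold sxc; rewrite sin_0; ring).
  apply (derive_pos_lt (fun y => - (y ^ 2 * sin y - 3 * sxc y)) (fun y => y * sxc y));
    [lra | |]; intros y Hy.
  + unfold sxc; auto_derive; [trivial | ring].
  + apply Rmult_lt_0_compat; [lra | apply sxc_pos; lra].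
Qed.

(** The logarithmic derivative of [cos x] divided by that of [sin x / x]. *)
Definition tau (x : R) : R := x * sin x ^ 2 / (cos x * sxc x).

(** The logarithmic derivative of [rho x / (sin x / x)] divided by [sxc x / (x * sin x)], which is
    minus the logarithmic derivative of [sin x / x]. *)
Definition alpha (x : R) : R := (x ^ 2 - 2 * sin x ^ 2 + x * sin x * cos x) / sxc x ^ 2.

Lemma tau_rho (x : R) : 0 < x < PI / 2 -> tau x = (sin x / x) ^ 2 / cos x / rho x.
Proof.
intros Hx; destruct (sin_cos_pos x Hx); generalize (sxc_pos x Hx); intros.
unfold tau, rho; field; lra.
Qed.

(** The square of [sin x / x] grows relative to [cos x], while the remaining denominator [rho]
    decreases. *)
Lemma tau_increasing : increasing_on tau (PI / 2).
Proof.
assert (H : increasing_on (fun x => (sin x / x) ^ 2 / cos x / rho x) (PI / 2)).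
{ apply (increasing_on_div (fun x => (sin x / x) ^ 2 / cos x)).
  - apply (derive_increasing _ (fun x =>
      sin x / (x ^ 3 * cos x ^ 2) * (x * (1 + cos x ^ 2) - 2 * sin x * cos x)));
      intros x Hx; destruct (sin_cos_pos x Hx) as [s0 c0].
    + auto_derive; [lra |].
      generalize (sin2_cos2 x); unfold Rsqr; intros E.
      replace (1 + cos x ^ 2) with (sin x ^ 2 + 2 * cos x ^ 2) by (simpl; lra).
      field; lra.
    + apply Rmult_lt_0_compat.
      * apply Rdiv_lt_0_compat; [exact s0 | apply Rmult_lt_0_compat; apply pow_lt; lra].
      * replace (x * (1 + cos x ^ 2) - 2 * sin x * cos x)
          with ((x - sin x) * (1 + cos x ^ 2) + sin x * (1 - cos x) ^ 2) by ring.
        generalize (sin_lt_x x (proj1 Hx)) (pow2_ge_0 (cos x)) (pow2_ge_0 (1 - cos x)).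
        intros; apply Rplus_lt_le_0_compat; [apply Rmult_lt_0_compat | apply Rmult_le_pos]; lra.
  - exact rho_decreasing.
  - intros x Hx; destruct (sin_cos_pos x Hx).
    apply Rdiv_lt_0_compat; [apply pow_lt, Rdiv_lt_0_compat |]; lra.
  - exact rho_pos. }
intros x y Hx Hxy Hy; rewrite !tau_rho by lra; apply H; lra.
Qed.

(** Once the limit 2/5 at 0 is split off, sharing the factor [x ^ 6] between numerator and
    denominator leaves an increasing function over a decreasing one. *)
Lemma alpha_rho (x : R) : 0 < x < PI / 2 ->
  alpha x = 2 / 5 + alpha_num (2 * x) / x ^ 6 / (20 * rho x ^ 2).
Proof.
intros Hx; generalize (sxc_pos x Hx); intros A0.
transitivity (2 / 5 + alpha_num (2 * x) / (20 * sxc x ^ 2));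
  [| unfold rho; field; lra].
assert (E : alpha_num (2 * x) = 20 * (x ^ 2 - 2 * sin x ^ 2 + x * sin x * cos x)
   - 8 * sxc x ^ 2).
{ unfold alpha_num, sxc; rewrite sin_2a, cos_2a.
  generalize (sin2_cos2 x); unfold Rsqr; intros E.
  assert (E' : cos x ^ 2 = 1 - sin x ^ 2) by (simpl; lra).
  ring [E']. }
rewrite E; unfold alpha; field; lra.
Qed.

Lemma alpha_increasing : increasing_on alpha (PI / 2).
Proof.
assert (H : increasing_on
  (fun x => alpha_num (2 * x) / x ^ 6 / (20 * rho x ^ 2)) (PI / 2)).
{ apply (increasing_on_div (fun x => alpha_num (2 * x) / x ^ 6)).
  - apply (derive_increasing _ (fun x => alpha_num_slope (2 * x) / x ^ 7)); intros x Hx.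
    + unfold alpha_num, alpha_num_slope; auto_derive;
        [repeat apply Rmult_integral_contrapositive_currified; lra | field; lra].
    + apply Rdiv_lt_0_compat; [apply alpha_num_slope_pos | apply pow_lt]; lra.
  - intros x y Hx Hxy Hy; generalize (rho_decreasing x y Hx Hxy Hy) (rho_pos y); nra.
  - intros x Hx; apply Rdiv_lt_0_compat; [apply alpha_num_bounds | apply pow_lt]; lra.
  - intros x Hx; generalize (rho_pos x Hx); nra. }
intros x y Hx Hxy Hy; rewrite !alpha_rho by lra.
apply Rplus_lt_compat_l, H; lra.
Qed.

(** Same splitting: 11/35 is the limit [2/5 - 3/35] at 0. The factor [cos x] in the denominator of
    [tau] brings in the angle [3 * x]. *)
Lemma alpha_tau_rho (x : R) : 0 < x < PI / 2 ->
  alpha x - tau x / 35 =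
  11 / 35 - alpha_tau_num x / x ^ 6 / (140 * (cos x * rho x ^ 2)).
Proof.
intros Hx; generalize (sxc_pos x Hx); intros A0; destruct (sin_cos_pos x Hx).
transitivity (11 / 35 - alpha_tau_num x / (140 * (cos x * sxc x ^ 2)));
  [| unfold rho; field; lra].
assert (E : alpha_tau_num x = 4 * (11 * cos x * sxc x ^ 2
   - 35 * (x ^ 2 - 2 * sin x ^ 2 + x * sin x * cos x) * cos x + x * sin x ^ 2 * sxc x)).
{ unfold alpha_tau_num, sxc; replace (3 * x) with (2 * x + x) by ring.
  rewrite sin_plus, cos_plus, sin_2a, cos_2a.
  generalize (sin2_cos2 x); unfold Rsqr; intros E.
  assert (E' : cos x ^ 2 = 1 - sin x ^ 2) by (simpl; lra).
  ring [E']. }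
rewrite E; unfold alpha, tau; field; lra.
Qed.

(** The factor 1/35 is the one for which the [x ^ 2] terms of the two expansions at 0 cancel; it is
    the origin of the threshold 34/35 for [q]. *)
Lemma alpha_tau_decreasing : decreasing_on (fun x => alpha x - tau x / 35) (PI / 2).
Proof.
assert (H : increasing_on
  (fun x => alpha_tau_num x / x ^ 6 / (140 * (cos x * rho x ^ 2))) (PI / 2)).
{ apply (increasing_on_div (fun x => alpha_tau_num x / x ^ 6)).
  - apply (derive_increasing _ (fun x => alpha_tau_num_slope x / x ^ 7)); intros x Hx.
    + unfold alpha_tau_num, alpha_tau_num_slope; auto_derive;
        [repeat apply Rmult_integral_contrapositive_currified; lra | field; lra].
    + apply Rdiv_lt_0_compat; [apply alpha_tau_num_slope_pos | apply pow_lt]; lra.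
  - intros x y Hx Hxy Hy.
    apply Rmult_lt_compat_l; [lra |].
    generalize (rho_decreasing x y Hx Hxy Hy) (rho_pos y); intros.
    apply Rmult_le_0_lt_compat; [left; apply sin_cos_pos; lra | apply pow2_ge_0 | | nra].
    apply cos_decreasing_1; lra.
  - intros x Hx; apply Rdiv_lt_0_compat; [apply alpha_tau_num_pos | apply pow_lt]; lra.
  - intros x Hx; destruct (sin_cos_pos x Hx).
    apply Rmult_lt_0_compat; [lra |].
    apply Rmult_lt_0_compat; [lra | apply pow_lt, rho_pos, Hx]. }
intros x y Hx Hxy Hy; rewrite !alpha_tau_rho by lra.
apply Rplus_lt_compat_l, Ropp_lt_contravar, H; lra.
Qed.

(** * Sign of a function from the monotonicity of its derivative ratio *)

Definition interval (b x : R) : Prop := 0 < x < b.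

(** With [u < l], all values close to [a] would exceed [u]. The point [a] may be either end of the
    interval. *)
Lemma limit1_in_le (f : R -> R) (b l u a : R) :
  limit1_in f (interval b) l a ->
  (forall d, 0 < d -> exists x, interval b x /\ Rabs (x - a) < d /\ f x <= u) -> l <= u.
Proof.
intros Hl Hu; apply Rnot_lt_le; intros Hlu.
destruct (Hl (l - u)) as [d [d0 Hd]]; [lra |].
destruct (Hu d d0) as [x [Hx [Hxa Hxu]]].
specialize (Hd x (conj Hx Hxa)); simpl in Hd; unfold R_dist in Hd.
apply Rabs_def2 in Hd; lra.
Qed.

Lemma limit1_in_subset (f : R -> R) (b c l a : R) :
  c <= b -> limit1_in f (interval b) l a -> limit1_in f (interval c) l a.
Proof.
intros Hcb Hf e He; destruct (Hf e He) as [d [d0 Hd]].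
exists d; split; [exact d0 |]; intros x [[Hx Hxc] Hxd].
apply Hd; repeat split; [lra | lra | exact Hxd].
Qed.

Lemma limit1_in_continuity (f g : R -> R) (D : R -> Prop) (l a : R) :
  limit1_in f D l a -> continuity_pt g l -> limit1_in (fun x => g (f x)) D (g l) a.
Proof.
intros Hf Hg e He; destruct (Hg e He) as [d [d0 Hd]].
destruct (Hf d d0) as [d' [d'0 Hd']].
exists d'; split; [exact d'0 |]; intros x Hx; specialize (Hd' x Hx).
(* [continuity_pt] speaks only of points other than [l], so the case [f x = l] is separate. *)
destruct (Req_dec (f x) l) as [-> | Hne].
- simpl; unfold R_dist; rewrite Rminus_diag, Rabs_R0; exact He.
- apply Hd; split; [split; [exact I | congruence] | exact Hd'].
Qed.

Lemma limit_opp_0 (f : R -> R) (D : R -> Prop) (a : R) :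
  limit1_in f D 0 a -> limit1_in (fun x => - f x) D 0 a.
Proof. intros H; rewrite <- Ropp_0 at 1; apply limit_Ropp, H. Qed.

(** The intermediate value at [x / 2] makes the inequality strict. *)
Lemma increasing_on_gt_limit (f : R -> R) (b l : R) :
  increasing_on f b -> limit1_in f (interval b) l 0 -> forall x, 0 < x < b -> l < f x.
Proof.
intros Hf Hl x Hx; apply Rle_lt_trans with (f (x / 2)); [| apply Hf; lra].
apply (limit1_in_le f b l _ 0 Hl); intros d d0.
exists (Rmin (d / 2) (x / 4)).
assert (Hm := Rmin_l (d / 2) (x / 4)); assert (Hm' := Rmin_r (d / 2) (x / 4)).
assert (Hm0 : 0 < Rmin (d / 2) (x / 4)) by (apply Rmin_pos; lra).
repeat split; [lra | lra | rewrite Rabs_right; lra | left; apply Hf; lra].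
Qed.

Lemma decreasing_on_lt_limit (f : R -> R) (b l : R) :
  decreasing_on f b -> limit1_in f (interval b) l 0 -> forall x, 0 < x < b -> f x < l.
Proof.
intros Hf Hl x Hx; apply Ropp_lt_cancel.
apply (increasing_on_gt_limit (fun y => - f y) b (- l)); [| apply limit_Ropp, Hl | exact Hx].
intros y z Hy Hyz Hz; apply Ropp_lt_contravar, Hf; assumption.
Qed.

Lemma pos_from_0 (f df : R -> R) (b : R) :
  limit1_in f (interval b) 0 0 ->
  (forall x, 0 < x < b -> is_derive f x (df x)) ->
  (forall x, 0 < x < b -> 0 < df x) -> forall x, 0 < x < b -> 0 < f x.
Proof.
intros Hl Hf Hdf x Hx.
assert (Hincr := derive_increasing f df b Hf Hdf).
exact (increasing_on_gt_limit f b 0 Hincr Hl x Hx).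
Qed.

(* [F' = w k] and [k' = v m] with positive weights, all vanishing at [0]: the
   sign of [m] propagates to [k] and then to [F]. *)
Definition sign_chain (F k m : R -> R) (b : R) : Prop :=
  limit1_in F (interval b) 0 0 /\ limit1_in k (interval b) 0 0 /\
  exists w v : R -> R, forall x, 0 < x < b ->
    0 < w x /\ 0 < v x /\ is_derive F x (w x * k x) /\ is_derive k x (v x * m x).

Lemma sign_chain_opp (F k m : R -> R) (b : R) :
  sign_chain F k m b ->
  sign_chain (fun x => - F x) (fun x => - k x) (fun x => - m x) b.
Proof.
intros [HF [Hk [w [v H]]]]; split; [| split].
- apply limit_opp_0, HF.
- apply limit_opp_0, Hk.
- exists w, v; intros x Hx; destruct (H x Hx) as [H1 [H2 [H3 H4]]].
  split; [exact H1 | split; [exact H2 | split]]; rewrite <- Ropp_mult_distr_r;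
    [apply (is_derive_opp (V := R_NormedModule) F), H3
    | apply (is_derive_opp (V := R_NormedModule) k), H4].
Qed.

Lemma sign_chain_le (F k m : R -> R) (b c : R) :
  c <= b -> sign_chain F k m b -> sign_chain F k m c.
Proof.
intros Hcb [HF [Hk [w [v H]]]].
split; [| split]; [eapply limit1_in_subset; eassumption .. |].
exists w, v; intros x Hx; apply H; lra.
Qed.

Lemma sign_chain_pos2 (F k m : R -> R) (b : R) :
  sign_chain F k m b -> (forall x, 0 < x < b -> 0 < m x) ->
  forall x, 0 < x < b -> 0 < k x /\ 0 < F x.
Proof.
intros [HF [Hk [w [v H]]]] Hm.
assert (k0 : forall x, 0 < x < b -> 0 < k x).
{ apply (pos_from_0 k (fun x => v x * m x)); [exact Hk | |];
    intros x Hx; destruct (H x Hx) as [H1 [H2 [H3 H4]]]; [exact H4 |].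
  apply Rmult_lt_0_compat; auto. }
intros x Hx; split; [exact (k0 x Hx) |]; revert x Hx.
apply (pos_from_0 F (fun x => w x * k x)); [exact HF | |];
  intros x Hx; destruct (H x Hx) as [H1 [H2 [H3 H4]]]; [exact H3 |].
apply Rmult_lt_0_compat; auto.
Qed.

Lemma sign_chain_pos (F k m : R -> R) (b : R) :
  sign_chain F k m b -> (forall x, 0 < x < b -> 0 < m x) ->
  forall x, 0 < x < b -> 0 < F x.
Proof. intros H Hm x Hx; apply (sign_chain_pos2 F k m b H Hm x Hx). Qed.

Lemma sign_chain_neg (F k m : R -> R) (b : R) :
  sign_chain F k m b -> (forall x, 0 < x < b -> m x < 0) ->
  forall x, 0 < x < b -> F x < 0.
Proof.
intros H Hm x Hx.
generalize (sign_chain_pos _ _ _ b (sign_chain_opp F k m b H)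
  (fun y Hy => Ropp_0_gt_lt_contravar _ (Hm y Hy)) x Hx); lra.
Qed.

(* If [F] also vanishes at the right end and [m] increases, then [F] first
   decreases and afterwards increases towards its final value [0]. *)
Lemma sign_chain_increasing (F k m : R -> R) (b : R) :
  sign_chain F k m b -> limit1_in F (interval b) 0 b -> increasing_on m b ->
  forall x, 0 < x < b -> F x < 0.
Proof.
intros H Hb Hm x Hx.
(* If [F] increases from [y] on, its limit 0 at [b] bounds the value at the midpoint of [y] and [b],
   which is larger than [F y]. *)
assert (Hend : forall y, 0 < y < b ->
    (forall z z', y <= z -> z < z' -> z' < b -> F z < F z') -> F y < 0).
{ intros y Hy Hmon.
  assert (Hmid : F ((y + b) / 2) <= 0).
  { apply Ropp_le_cancel; rewrite Ropp_0.
    apply (limit1_in_le (fun z => - F z) b 0 _ b).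
    - apply limit_opp_0, Hb.
    - intros d d0; exists (Rmax (b - d / 2) ((y + 3 * b) / 4)).
      assert (M1 := Rmax_l (b - d / 2) ((y + 3 * b) / 4)).
      assert (M2 := Rmax_r (b - d / 2) ((y + 3 * b) / 4)).
      assert (M3 : Rmax (b - d / 2) ((y + 3 * b) / 4) < b) by (apply Rmax_lub_lt; lra).
      repeat split; [lra | lra | rewrite Rabs_left; lra |].
      apply Ropp_le_contravar; left; apply Hmon; lra. }
  apply Rlt_le_trans with (2 := Hmid); apply Hmon; lra. }
destruct (Rlt_le_dec (F x) 0) as [h | HFx]; [exact h | exfalso].
assert (Hder := H); destruct Hder as [_ [_ [w [v Hder]]]].
assert (Hx0 : exists x0, 0 < x0 < x /\ forall y, 0 < y <= x0 -> k y < 0 /\ F y < 0).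
(* Otherwise [m] is positive on the whole interval, so [F] is positive and increasing, against its
   limit 0 at [b]. *)
{ assert (Hx0 : exists x0, 0 < x0 < x /\ m x0 <= 0).
  { apply NNPP; intros Hn.
    assert (Hpos : forall y, 0 < y < b -> 0 < m y).
    { intros y Hy; apply Rlt_le_trans with (m (Rmin y (x / 2) / 2)).
      - apply Rnot_le_lt; intros Hle; apply Hn; exists (Rmin y (x / 2) / 2).
        assert (M := Rmin_r y (x / 2)).
        assert (M0 : 0 < Rmin y (x / 2)) by (apply Rmin_pos; lra).
        split; [lra | exact Hle].
      - assert (M := Rmin_l y (x / 2)).
        assert (M0 : 0 < Rmin y (x / 2)) by (apply Rmin_pos; lra).
        left; apply Hm; lra. }
    assert (Hp := sign_chain_pos2 F k m b H Hpos).
    apply (Rlt_irrefl 0), Rlt_trans with (F x); [apply Hp, Hx |].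
    apply Hend; [exact Hx |]; intros z z' Hz Hzz' Hz'.
    apply (derive_increasing F (fun y => w y * k y) b); [| | lra ..]; intros y Hy;
      destruct (Hder y Hy) as [w0 [v0 [HF Hk]]]; [exact HF |].
    apply Rmult_lt_0_compat; [exact w0 | apply Hp, Hy]. }
  destruct Hx0 as [x0 [Hx0 Hmx0]].
  exists (x0 / 2); split; [lra |]; intros y Hy.
  assert (Hs := sign_chain_opp F k m x0 (sign_chain_le F k m b x0 ltac:(lra) H)).
  destruct (sign_chain_pos2 _ _ _ x0 Hs) with (x := y) as [Hk HF]; [| lra | lra].
  intros z Hz; generalize (Hm z x0); lra. }
destruct Hx0 as [x0 [Hx0 Hneg]].
destruct (Hneg x0) as [Hkx0 HFx0]; [lra |].
(* From [F x0 < 0 <= F x] comes a [c] with [k c > 0], and from [k x0 < 0 < k c] an [e < c] with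
   [m e > 0]. As [m] increases, it stays positive after [e], hence [k] stays positive after [c] and
   [F] increases from [x] on. *)
destruct (mean_value F (fun y => w y * k y) x0 x) as [c [Hc Ec]];
  [lra | intros y Hy; apply Hder; lra |].
assert (wc : 0 < w c) by (apply Hder; lra).
assert (kc : 0 < k c).
{ apply Rnot_le_lt; intros Hkc.
  assert (w c * k c <= 0) by nra; nra. }
destruct (mean_value k (fun y => v y * m y) x0 c) as [e [He Ee]];
  [lra | intros y Hy; apply Hder; lra |].
assert (ve : 0 < v e) by (apply Hder; lra).
assert (me : 0 < m e).
{ apply Rnot_le_lt; intros Hme.
  assert (v e * m e <= 0) by nra; nra. }
assert (kpos : forall y, c <= y < b -> 0 < k y).
{ intros y Hy; apply Rlt_le_trans with (k c); [exact kc |].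
  apply (derive_nonneg_le k (fun z => v z * m z)); [lra | |]; intros z Hz.
  - apply Hder; lra.
  - left; apply Rmult_lt_0_compat; [apply Hder; lra |].
    apply Rlt_trans with (m e); [exact me | apply Hm; lra]. }
apply (Rlt_irrefl 0), Rle_lt_trans with (F x); [exact HFx |].
apply Hend; [exact Hx |]; intros z z' Hz Hzz' Hz'.
apply (derive_pos_lt F (fun y => w y * k y)); [exact Hzz' | |]; intros y Hy.
- apply Hder; lra.
- apply Rmult_lt_0_compat; [apply Hder | apply kpos]; lra.
Qed.

Lemma sign_chain_decreasing (F k m : R -> R) (b : R) :
  sign_chain F k m b -> limit1_in F (interval b) 0 b -> decreasing_on m b ->
  forall x, 0 < x < b -> 0 < F x.
Proof.
intros H Hb Hm x Hx.
apply Ropp_lt_cancel; rewrite Ropp_0.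
apply (sign_chain_increasing (fun y => - F y) (fun y => - k y) (fun y => - m y) b).
- apply sign_chain_opp, H.
- apply limit_opp_0, Hb.
- intros y z Hy Hyz Hz; apply Ropp_lt_contravar, Hm; assumption.
- exact Hx.
Qed.

(** * Limits at the origin *)

Lemma limit_of_continuity (f : R -> R) (D : R -> Prop) (a : R) :
  continuity_pt f a -> limit1_in f D (f a) a.
Proof.
exact (fun H => limit1_in_continuity (fun x => x) f D a a (lim_x D a) H).
Qed.

Lemma limit1_in_ext (f g : R -> R) (D : R -> Prop) (l a : R) :
  (forall x, D x -> f x = g x) -> limit1_in f D l a -> limit1_in g D l a.
Proof.
intros E Hf e He; destruct (Hf e He) as [d [d0 Hd]].
exists d; split; [exact d0 |]; intros x Hx; rewrite <- E by apply Hx; auto.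
Qed.

Lemma limit1_in_quadratic (f : R -> R) (b l C : R) :
  0 < C -> (forall x, 0 < x < b -> x < 1 -> Rabs (f x - l) <= C * x ^ 2) ->
  limit1_in f (interval b) l 0.
Proof.
intros C0 Hf e He; exists (Rmin 1 (e / C)); split.
- apply Rmin_pos; [lra | apply Rdiv_lt_0_compat; lra].
- intros x [Hx Hd]; simpl in *; unfold R_dist in *.
  unfold interval in Hx; rewrite Rminus_0_r, Rabs_right in Hd by lra.
  assert (H1 : x < 1) by (generalize (Rmin_l 1 (e / C)); lra).
  assert (H2 : x < e / C) by (generalize (Rmin_r 1 (e / C)); lra).
  apply Rle_lt_trans with (1 := Hf x Hx H1).
  apply Rmult_lt_compat_l with (r := C) in H2; [| exact C0].
  replace (C * (e / C)) with e in H2 by (field; lra).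
  nra.
Qed.

Lemma limit_sinc : limit1_in (fun x => sin x / x) (interval (PI / 2)) 1 0.
Proof.
apply limit1_in_quadratic with 1; [lra |]; intros x Hx Hx1.
assert (H : x - / 6 * x ^ 3 <= sin x).
{ replace (sin x) with (sin (1 * x)) by (f_equal; ring).
  weighted_taylor 1%nat 1 x 0%nat; lra. }
assert (H' := sin_lt_x x (proj1 Hx)).
replace (sin x / x - 1) with (- ((x - sin x) / x)) by (field; lra).
rewrite Rabs_Ropp, Rabs_right;
  [| apply Rle_ge, Rlt_le, Rdiv_lt_0_compat; lra].
apply Rmult_le_reg_r with x; [lra |].
replace ((x - sin x) / x * x) with (x - sin x) by (field; lra).
assert (0 < x ^ 3) by (apply pow_lt; lra); simpl in *; nra.
Qed.

Lemma limit_rho : limit1_in rho (interval (PI / 2)) (1 / 3) 0.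
Proof.
apply limit1_in_quadratic with 1; [lra |]; intros x Hx Hx1.
assert (X0 : 0 < x ^ 3) by (apply pow_lt; lra).
assert (X1 : 0 < x ^ 5) by (apply pow_lt; lra).
assert (H : Rabs (sxc x - x ^ 3 / 3) <= x ^ 5).
{ unfold sxc.
  replace (sin x) with (sin (1 * x)) by (f_equal; ring).
  replace (cos x) with (cos (1 * x)) by (f_equal; ring).
  weighted_taylor 1%nat 1 x 0%nat.
  weighted_taylor 2%nat 1 x 0%nat.
  weighted_taylor 1%nat 1 x 1%nat.
  weighted_taylor 2%nat 1 x 1%nat.
  apply Rabs_le; lra. }
replace (rho x - 1 / 3) with ((sxc x - x ^ 3 / 3) / x ^ 3) by (unfold rho; field; lra).
unfold Rdiv; rewrite Rabs_mult, (Rabs_right (/ x ^ 3))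
  by (apply Rle_ge, Rlt_le, Rinv_0_lt_compat, X0).
apply Rmult_le_reg_r with (x ^ 3); [exact X0 |].
rewrite Rmult_assoc, Rinv_l by lra.
replace (1 * x ^ 2 * x ^ 3) with (x ^ 5) by ring; lra.
Qed.

Lemma limit_cos : limit1_in cos (interval (PI / 2)) 1 0.
Proof. rewrite <- cos_0; apply limit_of_continuity, continuity_cos. Qed.

Lemma limit_const (c : R) (D : R -> Prop) (a : R) : limit1_in (fun _ => c) D c a.
Proof. exact (limit_free (fun _ => c) D 0 a). Qed.

Lemma limit_tau : limit1_in tau (interval (PI / 2)) 3 0.
Proof.
apply (limit1_in_ext (fun x => (sin x / x) * (sin x / x) * / cos x * / rho x)).
- intros x Hx; rewrite tau_rho by exact Hx.
  generalize (rho_pos x Hx) (sin_cos_pos x Hx); intros; unfold interval in Hx; field; lra.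
- replace 3 with (1 * 1 * / 1 * / (1 / 3)) by field.
  repeat apply limit_mul; try apply limit_inv;
    [exact limit_sinc | exact limit_sinc | exact limit_cos | lra | exact limit_rho | lra].
Qed.

Lemma limit_alpha : limit1_in alpha (interval (PI / 2)) (2 / 5) 0.
Proof.
apply (limit1_in_ext (fun x => 2 / 5 + alpha_num (2 * x) / x ^ 6 * (/ 20 * (/ rho x * / rho x)))).
- intros x Hx; rewrite alpha_rho by exact Hx.
  generalize (rho_pos x Hx); intros; unfold interval in Hx; field; lra.
- replace (2 / 5) with (2 / 5 + 0 * (/ 20 * (/ (1 / 3) * / (1 / 3)))) at 1 by field.
  apply limit_plus; [apply limit_const |].
  repeat apply limit_mul; try apply limit_inv; try apply limit_const;
    try exact limit_rho; try lra.
  apply limit1_in_quadratic with 1; [lra |]; intros x Hx Hx1.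
  (* The upper Taylor bound makes the quotient by [x ^ 6] of order [x ^ 2]. *)
  destruct (alpha_num_bounds (2 * x)) as [H1 H2]; [lra |].
  assert (X0 : 0 < x ^ 6) by (apply pow_lt; lra).
  assert (X1 : 0 < x ^ 8) by (apply pow_lt; lra).
  rewrite Rminus_0_r, Rabs_right by (apply Rle_ge, Rlt_le, Rdiv_lt_0_compat; lra).
  apply Rmult_le_reg_r with (x ^ 6); [exact X0 |].
  unfold Rdiv; rewrite Rmult_assoc, Rinv_l by lra.
  replace (1 * x ^ 2 * x ^ 6) with (x ^ 8) by ring.
  rewrite Rmult_1_r; apply Rle_trans with (1 := H2).
  replace ((2 * x) ^ 8) with (256 * x ^ 8) by ring.
  assert (x ^ 2 <= 1) by nra; nra.
Qed.

(** * The power gap *)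

(* [gap p y] is the integral of [s ^ (p - 1)] over [[y, 1]]; in these terms
   [M] is defined by [gap p (M t p q) = gap q t / 3]. *)
Definition gap (p y : R) : R :=
  if Req_EM_T p 0 then - ln y else (1 - Rpower y p) / p.

Lemma is_derive_gap (p y : R) : 0 < y -> is_derive (gap p) y (- Rpower y (p - 1)).
Proof.
intros Hy; unfold gap; destruct (Req_EM_T p 0) as [-> | Hp].
- replace (0 - 1) with (- (1)) by ring.
  rewrite Rpower_Ropp, Rpower_1 by exact Hy.
  auto_derive; [exact Hy | field; lra].
- replace (Rpower y (p - 1)) with (Rpower y p / y).
  + unfold Rpower; auto_derive; [exact Hy | field; lra].
  + unfold Rminus; rewrite Rpower_plus, Rpower_Ropp, Rpower_1 by exact Hy; reflexivity.
Qed.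

Lemma continuity_gap (p y : R) : 0 < y -> continuity_pt (gap p) y.
Proof.
intros Hy; apply derivable_continuous_pt.
exists (- Rpower y (p - 1)); apply is_derive_Reals, is_derive_gap, Hy.
Qed.

Lemma gap_1 (p : R) : gap p 1 = 0.
Proof.
unfold gap; destruct (Req_EM_T p 0) as [-> | Hp]; [rewrite ln_1; ring |].
unfold Rpower; rewrite ln_1, Rmult_0_r, exp_0; field; exact Hp.
Qed.

Lemma Rpower_pos (x y : R) : 0 < Rpower x y.
Proof. apply exp_pos. Qed.

Lemma gap_decreasing (p y z : R) : 0 < y -> y < z -> gap p z < gap p y.
Proof.
intros Hy Hyz; apply Ropp_lt_cancel.
apply (derive_pos_lt (fun x => - gap p x) (fun x => Rpower x (p - 1))); [exact Hyz | |];
  intros x Hx; [| apply Rpower_pos].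
rewrite <- (Ropp_involutive (Rpower x (p - 1))).
apply (is_derive_opp (V := R_NormedModule) (gap p)), is_derive_gap; lra.
Qed.

Lemma gap_lt_iff (p y z : R) : 0 < y -> 0 < z -> (gap p y < gap p z <-> z < y).
Proof.
intros Hy Hz; split; [| exact (gap_decreasing p z y Hz)].
intros H; destruct (Rtotal_order y z) as [h | [-> | h]]; [| lra | exact h].
generalize (gap_decreasing p y z Hy h); lra.
Qed.

Lemma gap_pos (p y : R) : 0 < y < 1 -> 0 < gap p y.
Proof. intros Hy; rewrite <- (gap_1 p); apply gap_decreasing; lra. Qed.

Lemma Rpower_lt_1 (p q y : R) : 0 < y < 1 -> p < q -> Rpower y q < Rpower y p.
Proof.
intros Hy Hpq; apply exp_increasing.
assert (ln y < 0) by (rewrite <- ln_1; apply ln_increasing; lra); nra.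
Qed.

(** The integrands satisfy [s ^ (q - 1) < s ^ (p - 1)] for [s] in (0,1), and both gaps vanish at
    1. *)
Lemma gap_exponent_decreasing (p q y : R) : 0 < y < 1 -> p < q -> gap q y < gap p y.
Proof.
intros Hy Hpq.
assert (Hd : - (gap p y - gap q y) < - (gap p 1 - gap q 1)).
{ apply (derive_pos_lt (fun x => - (gap p x - gap q x))
    (fun x => Rpower x (p - 1) - Rpower x (q - 1))); [lra | |]; intros x Hx.
  - replace (Rpower x (p - 1) - Rpower x (q - 1))
      with (- (- Rpower x (p - 1) - - Rpower x (q - 1))) by ring.
    apply (is_derive_opp (V := R_NormedModule) (fun z => gap p z - gap q z)).
    apply is_derive_Rminus; apply is_derive_gap; lra.
  - apply Rlt_0_minus, Rpower_lt_1; lra. }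
rewrite !gap_1 in Hd; lra.
Qed.

Lemma gap_lt_inv (q y : R) : 0 < q -> 0 < y -> gap q y < / q.
Proof.
intros Hq Hy; unfold gap; destruct (Req_EM_T q 0) as [-> | _]; [lra |].
unfold Rdiv; rewrite <- (Rmult_1_l (/ q)) at 2.
apply Rmult_lt_compat_r; [apply Rinv_0_lt_compat, Hq |].
generalize (Rpower_pos y q); lra.
Qed.

Definition admissible (p q : R) : Prop := p <= 0 \/ (0 < p /\ p <= 3 * q).

(** For [p <> 0] the base of the outer power is [1 - p / 3 * gap q t] whether or not [q = 0]. It is
    positive: for [p <= 0] because the gap is positive, for [0 < p <= 3 * q] because the gap is
    below [/ q]. *)
Lemma M_gap (t p q : R) : 0 < t < 1 -> admissible p q ->
  0 < M t p q /\ gap p (M t p q) = gap q t / 3.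
Proof.
intros Ht Hpq.
assert (gq := gap_pos q t Ht).
unfold M; destruct (Req_EM_T p 0) as [-> | Hp].
- split; [destruct (Req_EM_T q 0); apply exp_pos |].
  unfold gap; destruct (Req_EM_T 0 0) as [_ | n]; [| lra].
  destruct (Req_EM_T q 0) as [-> | Hq].
  + unfold Rpower; rewrite ln_exp; field.
  + rewrite ln_exp; field; exact Hq.
- assert (Hb : 0 < 1 - p / 3 * gap q t).
  { destruct Hpq as [Hp0 | [Hp0 Hpq]]; [nra |].
    assert (h := gap_lt_inv q t ltac:(lra) ltac:(lra)).
    apply Rmult_lt_compat_l with (r := q) in h; [| lra].
    rewrite Rinv_r in h by lra; nra. }
  assert (Hr : forall b, 0 < b -> gap p (Rpower b (1 / p)) = (1 - b) / p).
  { intros b b0; unfold gap; destruct (Req_EM_T p 0) as [E | _]; [lra |].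
    rewrite Rpower_mult; replace (1 / p * p) with 1 by (field; exact Hp).
    rewrite Rpower_1 by exact b0; reflexivity. }
  split; [destruct (Req_EM_T q 0); apply Rpower_pos |].
  replace (if Req_EM_T q 0 then Rpower (1 + p / 3 * ln t) (1 / p)
    else Rpower (1 - p / (3 * q) + p / (3 * q) * Rpower t q) (1 / p))
    with (Rpower (1 - p / 3 * gap q t) (1 / p)).
  + rewrite Hr by exact Hb; field; exact Hp.
  + unfold gap; destruct (Req_EM_T q 0) as [-> | Hq]; f_equal; field; exact Hq.
Qed.

Lemma two_div_PI : 0 < 2 / PI < 1.
Proof.
generalize PI2_1; intros; split; [apply Rdiv_lt_0_compat; lra |].
apply Rmult_lt_reg_r with PI; [lra |].
unfold Rdiv; rewrite Rmult_assoc, Rinv_l by lra; lra.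
Qed.

(** For [q > 0], [gap q t] tends to [/ q] as [t] tends to 0. So [qfun p] is the positive [q] for
    which [gap p (sin x / x) - gap q (cos x) / 3] tends to 0 at [PI / 2]. *)
Lemma qfun_gap (p : R) : 0 < qfun p /\ gap p (2 / PI) = / (3 * qfun p).
Proof.
assert (Hpi := two_div_PI).
assert (g0 := gap_pos p _ Hpi).
assert (E : qfun p = / (3 * gap p (2 / PI))).
{ unfold qfun; unfold gap in *; destruct (Req_EM_T p 0) as [-> | Hp].
  - field; lra.
  - remember (Rpower (2 / PI) p) as r.
    field; split; [exact Hp |]; intros h.
    unfold Rdiv in g0; rewrite h in g0; lra. }
rewrite E; split; [apply Rinv_0_lt_compat; lra | field; lra].
Qed.

Lemma qfun_le (p q : R) : p <= q -> qfun p <= qfun q.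
Proof.
intros [Hpq | ->]; [| lra].
assert (h := gap_exponent_decreasing p q _ two_div_PI Hpq).
destruct (qfun_gap p) as [qp Ep]; destruct (qfun_gap q) as [qq Eq].
rewrite Ep, Eq in h.
apply Rnot_lt_le; intros h'; apply (Rlt_irrefl (/ (3 * qfun p))).
apply Rlt_trans with (2 := h), Rinv_lt_contravar; nra.
Qed.

(** * Comparison of [sin x / x] with [M (cos x) p q] *)

Definition gap_diff (p q x : R) : R := gap p (sin x / x) - gap q (cos x) / 3.

Lemma sinc_bounds (x : R) : 0 < x < PI / 2 -> 0 < sin x / x < 1.
Proof.
intros Hx; destruct (sin_cos_pos x Hx); split; [apply Rdiv_lt_0_compat; lra |].
apply Rmult_lt_reg_r with x; [lra |].
unfold Rdiv; rewrite Rmult_assoc, Rinv_l by lra.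
generalize (sin_lt_x x); lra.
Qed.

Lemma cos_bounds (x : R) : 0 < x < PI / 2 -> 0 < cos x < 1.
Proof.
intros Hx; split; [apply sin_cos_pos, Hx |].
rewrite <- cos_0; apply cos_decreasing_1; lra.
Qed.

Lemma sinc_lt_M (p q x : R) : admissible p q -> 0 < x < PI / 2 ->
  (sin x / x < M (cos x) p q <-> 0 < gap_diff p q x).
Proof.
intros Hpq Hx; destruct (M_gap (cos x) p q (cos_bounds x Hx) Hpq) as [M0 E].
rewrite <- (gap_lt_iff p) by (apply sinc_bounds || exact M0; exact Hx).
unfold gap_diff; rewrite E; lra.
Qed.

Lemma M_lt_sinc (p q x : R) : admissible p q -> 0 < x < PI / 2 ->
  (sin x / x > M (cos x) p q <-> gap_diff p q x < 0).
Proof.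
intros Hpq Hx; destruct (M_gap (cos x) p q (cos_bounds x Hx) Hpq) as [M0 E].
unfold Rgt; rewrite <- (gap_lt_iff p) by (apply sinc_bounds || exact M0; exact Hx).
unfold gap_diff; rewrite E; lra.
Qed.

(** The quotient of the derivatives of [gap p (sin x / x)] and [gap q (cos x)], minus 1/3, arranged
    in factors that each have a finite nonzero limit at 0. *)
Definition gap_ratio (p q x : R) : R :=
  Rpower (sin x / x) (p - 1) * Rpower (cos x) (1 - q) * (rho x * / (sin x / x)) - 1 / 3.

(* The logarithmic derivative of [gap_ratio + 1/3], up to a positive factor. *)
Definition log_slope (p q x : R) : R := alpha x + (q - 1) * tau x - (p - 1).

Lemma is_derive_sinc (x : R) : x <> 0 ->
  is_derive (fun y => sin y / y) x (- sxc x / x ^ 2).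
Proof. intros Hx; unfold sxc; auto_derive; [exact Hx | field; exact Hx]. Qed.

Lemma is_derive_gap_diff (p q x : R) : 0 < x < PI / 2 ->
  is_derive (gap_diff p q) x (Rpower (cos x) (q - 1) * sin x * gap_ratio p q x).
Proof.
intros Hx; destruct (sin_cos_pos x Hx) as [s0 c0].
assert (E : Rpower (cos x) (1 - q) = / Rpower (cos x) (q - 1)).
{ rewrite <- Rpower_Ropp; f_equal; ring. }
assert (C := Rpower_pos (cos x) (q - 1)).
replace (Rpower (cos x) (q - 1) * sin x * gap_ratio p q x)
  with (- sxc x / x ^ 2 * - Rpower (sin x / x) (p - 1)
    - - sin x * - Rpower (cos x) (q - 1) * / 3).
- apply is_derive_Rminus.
  + apply (is_derive_comp (gap p) (fun y => sin y / y));
      [apply is_derive_gap, sinc_bounds, Hx | apply is_derive_sinc; lra].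
  + unfold Rdiv.
    apply (is_derive_ext (fun y => / 3 * gap q (cos y))); [intros; apply Rmult_comm |].
    rewrite Rmult_comm; apply is_derive_scal.
    apply (is_derive_comp (gap q) cos);
      [apply is_derive_gap, c0 | apply is_derive_Reals, derivable_pt_lim_cos].
- unfold gap_ratio, rho; rewrite E; field; lra.
Qed.

(** Logarithmic differentiation of the product. Taking out [sxc x / (x * sin x)] gives [p - 1] a
    constant coefficient. *)
Lemma is_derive_gap_ratio (p q x : R) : 0 < x < PI / 2 ->
  is_derive (gap_ratio p q) x
    ((gap_ratio p q x + 1 / 3) * (sxc x / (x * sin x)) * log_slope p q x).
Proof.
intros Hx; destruct (sin_cos_pos x Hx) as [s0 c0].
assert (A0 := sxc_pos x Hx); destruct (sinc_bounds x Hx) as [S0 _].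
assert (Ei : sin x * / x = sin x / x) by reflexivity.
unfold gap_ratio, Rpower, rho, log_slope, alpha, tau, sxc in *.
auto_derive; [rewrite Ei; repeat split; try lra;
  repeat apply Rmult_integral_contrapositive_currified; lra |].
unfold Rdiv in *.
(* With the two powers as atoms, the identity is rational in [x], [sin x], [cos x], modulo the
   Pythagorean relation. *)
set (u := exp ((p - 1) * _)); set (v := exp ((1 - q) * _)).
assert (E2 : cos x ^ 2 = 1 - sin x ^ 2)
  by (generalize (sin2_cos2 x); unfold Rsqr; simpl; lra).
field_simplify_eq; [| lra].
ring [E2].
Qed.

Lemma limit_gap_ratio (p q : R) : limit1_in (gap_ratio p q) (interval (PI / 2)) 0 0.
Proof.
assert (cont : forall r, continuity_pt (fun y => Rpower y r) 1).
{ intros r; apply derivable_continuous_pt; exists (r * Rpower 1 (r - 1)).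
  apply derivable_pt_lim_power; lra. }
assert (E : forall r, Rpower 1 r = 1)
  by (intros r; unfold Rpower; rewrite ln_1, Rmult_0_r; apply exp_0).
assert (L : forall f r, limit1_in f (interval (PI / 2)) 1 0 ->
  limit1_in (fun x => Rpower (f x) r) (interval (PI / 2)) 1 0).
{ intros f r Hf.
  assert (H := limit1_in_continuity f (fun y => Rpower y r) _ 1 0 Hf (cont r)).
  simpl in H; rewrite E in H; exact H. }
replace 0 with (1 * 1 * (1 / 3 * / 1) - 1 / 3) at 1 by field.
apply limit_minus; [| apply limit_const].
apply limit_mul; apply limit_mul.
- exact (L _ (p - 1) limit_sinc).
- exact (L _ (1 - q) limit_cos).
- exact limit_rho.
- apply limit_inv; [exact limit_sinc | lra].
Qed.

Lemma limit_gap_diff (p q : R) : limit1_in (gap_diff p q) (interval (PI / 2)) 0 0.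
Proof.
replace 0 with (gap p 1 - gap q 1 * / 3) at 1 by (rewrite !gap_1; ring).
apply limit_minus; [| apply limit_mul; [| apply limit_const]].
- apply (limit1_in_continuity (fun x => sin x / x) (gap p));
    [exact limit_sinc | apply continuity_gap; lra].
- apply (limit1_in_continuity cos (gap q));
    [exact limit_cos | apply continuity_gap; lra].
Qed.

Lemma gap_sign_chain (p q : R) :
  sign_chain (gap_diff p q) (gap_ratio p q) (log_slope p q) (PI / 2).
Proof.
split; [apply limit_gap_diff | split; [apply limit_gap_ratio |]].
exists (fun x => Rpower (cos x) (q - 1) * sin x),
  (fun x => (gap_ratio p q x + 1 / 3) * (sxc x / (x * sin x))).
intros x Hx; destruct (sin_cos_pos x Hx) as [s0 c0].
split; [| split; [| split]].
- apply Rmult_lt_0_compat; [apply Rpower_pos | exact s0].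
- unfold gap_ratio; apply Rmult_lt_0_compat.
  + match goal with |- 0 < ?a - _ + _ => cut (0 < a); [lra |] end.
    apply Rmult_lt_0_compat; apply Rmult_lt_0_compat;
      [apply Rpower_pos .. | apply rho_pos, Hx | apply Rinv_0_lt_compat, sinc_bounds, Hx].
  + apply Rdiv_lt_0_compat; [apply sxc_pos, Hx | apply Rmult_lt_0_compat; lra].
- apply is_derive_gap_diff, Hx.
- apply is_derive_gap_ratio, Hx.
Qed.

Lemma log_slope_increasing (p q : R) : 1 <= q -> increasing_on (log_slope p q) (PI / 2).
Proof.
intros Hq x y Hx Hxy Hy; unfold log_slope.
assert (h1 := alpha_increasing x y Hx Hxy Hy).
assert (h2 := tau_increasing x y Hx Hxy Hy); nra.
Qed.

(** Write [q - 1] as [- 1 / 35] plus the nonpositive [q - 34 / 35]: the first part is absorbed by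
    [alpha], the second multiplies the increasing [tau]. *)
Lemma log_slope_decreasing (p q : R) :
  q <= 34 / 35 -> decreasing_on (log_slope p q) (PI / 2).
Proof.
intros Hq x y Hx Hxy Hy; unfold log_slope.
assert (h1 := alpha_tau_decreasing x y Hx Hxy Hy); simpl in h1.
assert (h2 := tau_increasing x y Hx Hxy Hy); nra.
Qed.

Lemma limit_log_slope (p q : R) :
  limit1_in (log_slope p q) (interval (PI / 2)) (3 * q - p - 8 / 5) 0.
Proof.
replace (3 * q - p - 8 / 5) with (2 / 5 + (q - 1) * 3 - (p - 1)) by field.
apply limit_minus; [| apply limit_const].
apply limit_plus; [exact limit_alpha |].
apply limit_mul; [apply limit_const | exact limit_tau].
Qed.

(** * Conditions on [q] from the behaviour at the two ends of the interval *)

Lemma limit_pos_near (f : R -> R) (b l : R) :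
  0 < b -> limit1_in f (interval b) l 0 -> 0 < l ->
  exists d, 0 < d <= b /\ forall x, 0 < x < d -> 0 < f x.
Proof.
intros b0 Hf l0; destruct (Hf l l0) as [d [d0 Hd]].
exists (Rmin d b); assert (M1 := Rmin_l d b); assert (M2 := Rmin_r d b).
split; [split; [apply Rmin_pos; lra | lra] |]; intros x Hx.
assert (h : Rabs (f x - l) < l).
{ apply Hd; split; [split; lra |]; simpl; unfold R_dist.
  rewrite Rminus_0_r, Rabs_right; lra. }
apply Rabs_def2 in h; lra.
Qed.

(** Continuity at 0 does not give this, since [ln 0 = 0] makes [Rpower 0 q] equal to 1. The
    tolerance [e] is met as soon as [cos x] is below [Rpower e (/ q)]. *)
Lemma limit_Rpower_cos (q : R) : 0 < q ->
  limit1_in (fun x => Rpower (cos x) q) (interval (PI / 2)) 0 (PI / 2).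
Proof.
intros Hq e He.
assert (Hc : limit1_in cos (interval (PI / 2)) 0 (PI / 2))
  by (rewrite <- cos_PI2; apply limit_of_continuity, continuity_cos).
destruct (Hc (Rpower e (/ q)) (Rpower_pos _ _)) as [d [d0 Hd]].
exists d; split; [exact d0 |]; intros x [Hx Hxd].
specialize (Hd x (conj Hx Hxd)); simpl in *; unfold R_dist in *.
destruct (sin_cos_pos x Hx) as [_ c0].
rewrite Rminus_0_r, Rabs_right in Hd by lra.
rewrite Rminus_0_r, Rabs_right by (left; apply Rpower_pos).
replace e with (Rpower (Rpower e (/ q)) q)
  by (rewrite Rpower_mult, Rinv_l, Rpower_1; lra).
apply Rlt_Rpower_l; lra.
Qed.

Lemma limit_gap_diff_PI2 (p q : R) : 0 < q ->
  limit1_in (gap_diff p q) (interval (PI / 2)) (/ (3 * qfun p) - / (3 * q)) (PI / 2).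
Proof.
intros Hq; destruct (qfun_gap p) as [_ <-].
assert (HPI := PI_RGT_0).
apply limit_minus.
- replace (2 / PI) with (sin (PI / 2) / (PI / 2)) by (rewrite sin_PI2; field; lra).
  apply (limit_of_continuity (fun x => gap p (sin x / x))).
  apply derivable_continuous_pt; eexists; apply is_derive_Reals.
  apply (is_derive_comp (gap p) (fun y => sin y / y));
    [apply is_derive_gap | apply is_derive_sinc; lra].
  rewrite sin_PI2; apply Rdiv_lt_0_compat; lra.
- replace (/ (3 * q)) with ((1 - 0) * / q * / 3) by (field; lra).
  apply (limit1_in_ext (fun x => (1 - Rpower (cos x) q) * / q * / 3)).
  + intros x _; unfold gap; destruct (Req_EM_T q 0) as [E | _]; [lra | reflexivity].
  + apply limit_mul; [apply limit_mul; [apply limit_minus |] |]; try apply limit_const.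
    apply limit_Rpower_cos, Hq.
Qed.

Lemma gap_diff_qfun_limit (p : R) :
  limit1_in (gap_diff p (qfun p)) (interval (PI / 2)) 0 (PI / 2).
Proof.
rewrite <- (Rminus_diag (/ (3 * qfun p))) at 1.
apply limit_gap_diff_PI2, qfun_gap.
Qed.

(** Reduces sufficiency in the two [qfun] cases to [q = qfun p]. *)
Lemma gap_diff_exponent_le (p q r x : R) : 0 < x < PI / 2 -> q <= r ->
  gap_diff p q x <= gap_diff p r x.
Proof.
intros Hx [Hqr | ->]; [| lra]; unfold gap_diff.
generalize (gap_exponent_decreasing q r _ (cos_bounds x Hx) Hqr); lra.
Qed.

(** For larger [q] the limit of [log_slope] at 0 is positive, and the sign chain on a short interval
    makes [gap_diff] positive near 0. *)
Lemma gap_diff_neg_necessary (p q : R) :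
  (forall x, 0 < x < PI / 2 -> gap_diff p q x < 0) -> q <= p / 3 + 8 / 15.
Proof.
intros H; apply Rnot_lt_le; intros Hq; assert (HPI := PI2_RGT_0).
destruct (limit_pos_near _ _ _ HPI (limit_log_slope p q)) as [d [Hd Hpos]]; [lra |].
assert (h := sign_chain_pos _ _ _ d (sign_chain_le _ _ _ _ d (proj2 Hd) (gap_sign_chain p q))
  Hpos (d / 2)).
specialize (H (d / 2)); lra.
Qed.

Lemma gap_diff_pos_necessary (p q : R) :
  (forall x, 0 < x < PI / 2 -> 0 < gap_diff p q x) -> p / 3 + 8 / 15 <= q.
Proof.
intros H; apply Rnot_lt_le; intros Hq; assert (HPI := PI2_RGT_0).
destruct (limit_pos_near _ _ _ HPI (limit_Ropp _ _ _ _ (limit_log_slope p q)))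
  as [d [Hd Hpos]]; [lra |].
assert (h := sign_chain_neg _ _ _ d
  (sign_chain_le _ _ _ _ d (proj2 Hd) (gap_sign_chain p q))).
enough (gap_diff p q (d / 2) < 0) by (specialize (H (d / 2)); lra).
apply h; [| lra]; intros x Hx; specialize (Hpos x Hx); simpl in Hpos; lra.
Qed.

Lemma near_PI2 (d : R) : 0 < d -> exists x, interval (PI / 2) x /\ Rabs (x - PI / 2) < d.
Proof.
intros d0; assert (HPI := PI2_RGT_0).
exists (PI / 2 - Rmin (d / 2) (PI / 4)).
assert (M1 := Rmin_l (d / 2) (PI / 4)); assert (M2 := Rmin_r (d / 2) (PI / 4)).
assert (M0 : 0 < Rmin (d / 2) (PI / 4)) by (apply Rmin_pos; lra).
repeat split; [lra | lra | rewrite Rabs_left; lra].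
Qed.

(** The sign passes to the limit at [PI / 2], which compares [/ (3 * qfun p)] with [/ (3 * q)]. *)
Lemma gap_diff_neg_end (p q : R) : 0 < q ->
  (forall x, 0 < x < PI / 2 -> gap_diff p q x <= 0) -> q <= qfun p.
Proof.
intros Hq H; destruct (qfun_gap p) as [Hp _].
assert (h : / (3 * qfun p) - / (3 * q) <= 0).
{ apply (limit1_in_le _ _ _ _ _ (limit_gap_diff_PI2 p q Hq)); intros d d0.
  destruct (near_PI2 d d0) as [x [Hx Hd]]; exists x; auto. }
apply Rnot_lt_le; intros hlt.
assert (/ (3 * q) < / (3 * qfun p)) by (apply Rinv_lt_contravar; nra); lra.
Qed.

Lemma gap_diff_pos_end (p q : R) : 0 < q ->
  (forall x, 0 < x < PI / 2 -> 0 <= gap_diff p q x) -> qfun p <= q.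
Proof.
intros Hq H; destruct (qfun_gap p) as [Hp _].
assert (h : - (/ (3 * qfun p) - / (3 * q)) <= 0).
{ apply (limit1_in_le _ _ _ _ _ (limit_Ropp _ _ _ _ (limit_gap_diff_PI2 p q Hq)));
    intros d d0.
  destruct (near_PI2 d d0) as [x [Hx Hd]]; exists x; specialize (H x Hx); repeat split;
    [apply Hx | apply Hx | exact Hd | lra]. }
apply Rnot_lt_le; intros hlt.
assert (/ (3 * qfun p) < / (3 * q)) by (apply Rinv_lt_contravar; nra); lra.
Qed.

Theorem theorem3 (p0 p0s : R) (Hp0 : qfun p0 = 1) (Hp0s : qfun p0s = 34 / 35) :
  forall p q : R, (p <= 0 \/ (0 < p /\ p <= 3 * q)) ->
  (7 / 5 <= p ->
     ((forall x, 0 < x < PI / 2 -> sin x / x < M (cos x) p q) <-> p / 3 + 8 / 15 <= q)) /\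
  (p0 <= p ->
     ((forall x, 0 < x < PI / 2 -> sin x / x > M (cos x) p q) <-> q <= qfun p)) /\
  (p <= 46 / 35 ->
     ((forall x, 0 < x < PI / 2 -> sin x / x > M (cos x) p q) <-> q <= p / 3 + 8 / 15)) /\
  (p <= p0s ->
     ((forall x, 0 < x < PI / 2 -> sin x / x < M (cos x) p q) <-> qfun p <= q)).
Proof.
intros p q Hpq.
assert (Hlt := fun x => sinc_lt_M p q x Hpq).
assert (Hgt := fun x => M_lt_sinc p q x Hpq).
assert (chain := gap_sign_chain p q).
assert (slope0 := limit_log_slope p q).
destruct (qfun_gap p) as [qp0 _].
split; [| split; [| split]]; intros Hp; split; intros H.
- apply gap_diff_pos_necessary; intros x Hx; apply Hlt; auto.
- intros x Hx; apply Hlt; [exact Hx |]; revert x Hx.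
  apply (sign_chain_pos _ _ _ _ chain); intros x Hx.
  (* Here [q >= 7/15 + 8/15 = 1], and the limit of [log_slope] at 0 is nonnegative. *)
  generalize (increasing_on_gt_limit _ _ _
    (log_slope_increasing p q ltac:(lra)) slope0 x Hx); lra.
(* The limit at [PI / 2] is available for [q > 0]; otherwise [qfun p > 0] suffices. *)
- destruct (Rle_lt_dec q 0) as [Hq | Hq]; [lra |].
  apply gap_diff_neg_end; [exact Hq |]; intros x Hx; left; apply Hgt; auto.
- intros x Hx; apply Hgt; [exact Hx |].
  apply Rle_lt_trans with (1 := gap_diff_exponent_le p q (qfun p) x Hx H).
  revert x Hx; apply (sign_chain_increasing _ _ _ _ (gap_sign_chain p (qfun p))).
  + apply gap_diff_qfun_limit.
  + apply log_slope_increasing; rewrite <- Hp0; apply qfun_le, Hp.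
- apply gap_diff_neg_necessary; intros x Hx; apply Hgt; auto.
- intros x Hx; apply Hgt; [exact Hx |]; revert x Hx.
  apply (sign_chain_neg _ _ _ _ chain); intros x Hx.
  (* Here [q <= 46/105 + 8/15 = 34/35], and the limit of [log_slope] at 0 is at most 0. *)
  generalize (decreasing_on_lt_limit _ _ _
    (log_slope_decreasing p q ltac:(lra)) slope0 x Hx); lra.
(* As [q] may be nonpositive, it is raised to the maximum of [q] and [qfun p / 2]: this is positive,
   still below [qfun p], and keeps [gap_diff] positive. *)
- apply Rnot_lt_le; intros Hq.
  assert (M1 := Rmax_l q (qfun p / 2)); assert (M2 := Rmax_r q (qfun p / 2)).
  assert (M3 : Rmax q (qfun p / 2) < qfun p) by (apply Rmax_lub_lt; lra).
  apply (Rlt_not_le _ _ M3), gap_diff_pos_end; [lra |]; intros x Hx.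
  apply Rle_trans with (2 := gap_diff_exponent_le p q _ x Hx M1).
  left; apply Hlt; auto.
- intros x Hx; apply Hlt; [exact Hx |].
  apply Rlt_le_trans with (2 := gap_diff_exponent_le p (qfun p) q x Hx H).
  revert x Hx; apply (sign_chain_decreasing _ _ _ _ (gap_sign_chain p (qfun p))).
  + apply gap_diff_qfun_limit.
  + apply log_slope_decreasing; rewrite <- Hp0s; apply qfun_le, Hp.
Qed.
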